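(* Let $A$ be a commutative, semisimple and regular Banach algebra and let $\varphi\in\Phi(A)$. If $\{\varphi\}$ is a spectral set for $A$, then for every Banach $\varphi$-$A$-bimodule $X$, every derivation $D:A\rightarrow X^\ast$ is zero.
   Context: $\Phi(A)$ is the character space of the commutative Banach algebra $A$, i.e. the set of nonzero homomorphisms $A\to\mathbb{C}$, with the $w^\ast$-topology; $I_\varphi(A)=\{a\in A:\varphi(a)=0\}$. For an ideal $J$ of $A$ put $Co(J)=\{\phi\in\Phi(A):\phi(a)=0 \text{ for all } a\in J\}$. The set $\{\varphi\}$ is a spectral set (set of spectral synthesis) for $A$ if $I_\varphi(A)$ is the only closed ideal $J$ of $A$ with $Co(J)=\{\varphi\}$. A Banach $\varphi$-$A$-bimodule is a Banach $A$-bimodule $X$ with $a\cdot x=x\cdot a=\varphi(a)x$ for all $a\in A$, $x\in X$; its dual $X^\ast$ carries the canonical dual bimodule structure, so that $a\cdot\psi=\psi\cdot a=\varphi(a)\psi$ for $a\in A$, $\psi\in X^\ast$. A derivation $D:A\rightarrow X^\ast$ is a continuous linear map with $D(ab)=D(a)\cdot b+a\cdot D(b)$ for all $a,b\in A$; in the present case this reads $D(ab)=\varphi(a)D(b)+\varphi(b)D(a)$. *)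

(* Defs.v *)
From HB Require Import structures.
From mathcomp Require Import all_boot all_order all_algebra.
From mathcomp Require Import complex.
From mathcomp Require Import all_classical all_reals.
From mathcomp Require Import topology normedtype.

Set Implicit Arguments.
Unset Strict Implicit.
Unset Printing Implicit Defensive.

Import Order.TTheory GRing.Theory Num.Theory.
Import numFieldNormedType.Exports.

Local Open Scope classical_set_scope.
Local Open Scope ring_scope.
Local Open Scope complex_scope.

(* The scalar field is R[i] for R : realType.  Norms of normed R[i]-modules
   take their values in R[i]; they are nonnegative, hence real.  The type R[i]
   carries its topology through the alias R[i]^o. *)

(* Algebras are not assumed to be unital, so the ringType hierarchy cannot be
   used for the product. *)
HB.mixin Record isComBanachAlgebra (R : realType) A
    & CompleteNormedModule R[i] A := {
  bmul : A -> A -> A;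
  bmulA : associative bmul;
  bmulC : commutative bmul;
  bmulDl : left_distributive bmul +%R;
  bmulZl : forall (k : R[i]) (a b : A), bmul (k *: a) b = k *: bmul a b;
  bnormM : forall a b : A, `|bmul a b| <= `|a| * `|b|
}.

#[short(type="comBanachAlgType")]
HB.structure Definition ComBanachAlgebra (R : realType) :=
  {A of CompleteNormedModule R[i] A & isComBanachAlgebra R A}.

Notation "a ** b" := (bmul a b) (at level 40, left associativity) : ring_scope.

Section Ideals.
Variables (R : realType) (A : comBanachAlgType R).

Definition ideal (J : set A) : Prop :=
  [/\ J 0,
      (forall a b, J a -> J b -> J (a + b)),
      (forall (k : R[i]) a, J a -> J (k *: a))
    & (forall a b, J b -> J (a ** b))].

Definition closed_ideal (J : set A) : Prop := closed J /\ ideal J.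

(* u is an identity modulo M *)
Definition modular (M : set A) : Prop := exists u, forall a, M (a - u ** a).

Definition maximal_modular_ideal (M : set A) : Prop :=
  [/\ ideal M, modular M, M <> setT
    & forall J, ideal J -> M `<=` J -> J <> setT -> J = M].

(* The Jacobson radical; it is all of A when there is no maximal modular
   ideal. *)
Definition radical : set A := \bigcap_(M in maximal_modular_ideal) M.

Definition semisimple : Prop := radical = [set 0].

End Ideals.

Arguments semisimple {R} A.

Section CharacterSpace.
Variables (R : realType) (A : comBanachAlgType R).

(* Used as a type, this set carries the topology induced by
   {ptws A -> R[i]^o}, that is, the weak-* topology. *)
Definition character_space : set {ptws A -> R[i]^o} :=
  [set phi | [/\ linear (phi : A -> R[i]^o),
                 (forall a b, phi (a ** b) = phi a * phi b)
               & exists a, phi a != 0]].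

Definition char_eval (phi : character_space) (a : A) : R[i] := \val phi a.

Definition char_ker (phi : character_space) : set A :=
  [set a | char_eval phi a = 0].

Definition Co (J : set A) : set character_space :=
  [set psi | forall a, J a -> char_eval psi a = 0].

Definition regular : Prop :=
  forall (E : set character_space) (phi : character_space),
    closed E -> ~ E phi ->
    exists a, char_eval phi a != 0 /\
              forall psi, E psi -> char_eval psi a = 0.

(* The singleton {phi} is a set of spectral synthesis. *)
Definition spectral_singleton (phi : character_space) : Prop :=
  [set J | closed_ideal J /\ Co J = [set phi]] = [set char_ker phi].

End CharacterSpace.

Arguments character_space {R} A.
Arguments regular {R} A.

Section Dual.
Variables (R : realType) (X : normedModType R[i]).

Definition is_functional : {pred X -> R[i]^o} :=
  fun f => `[< linear f /\ continuous f >].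

Lemma is_functional_submod_closed : submod_closed is_functional.
Proof.
split.
  apply/asboolP; split; last exact: cst_continuous.
  by move=> k x y; change (0 = k *: 0 + 0 :> R[i]^o); rewrite scaler0 addr0.
move=> k f g /asboolP[lf cf] /asboolP[lg cg]; apply/asboolP; split.
  move=> c x y.
  change (k *: f (c *: x + y) + g (c *: x + y) =
    c *: (k *: f x + g x) + (k *: f y + g y)).
  by rewrite lf lg !scalerDr !scalerA (mulrC k c) addrACA.
by move=> x; apply: cvgD; [apply: cvgZr; exact: cf|exact: cg].
Qed.

HB.instance Definition _ :=
  GRing.isSubmodClosed.Build R[i] (X -> R[i]^o) is_functional
    is_functional_submod_closed.

Record dual_space := DualSpace {
  dual_val :> X -> R[i]^o;
  dual_valP : dual_val \in is_functional
}.

HB.instance Definition _ := [isSub for dual_val].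
HB.instance Definition _ := [Choice of dual_space by <:].
HB.instance Definition _ := [SubChoice_isSubLmodule of dual_space by <:].

Implicit Types f g : dual_space.

Lemma dual_linear f : linear f.
Proof. by have /asboolP[] := dual_valP f. Qed.

Lemma dual_continuous f : continuous f.
Proof. by have /asboolP[] := dual_valP f. Qed.

HB.instance Definition _ f :=
  GRing.isLinear.Build R[i] X R[i]^o *:%R (dual_val f) (dual_linear f).

Lemma dualDE f g x : (f + g) x = f x + g x. Proof. by []. Qed.

Lemma dualZE (k : R[i]) f x : (k *: f) x = k * f x. Proof. by []. Qed.

Lemma dual_eqP f g : (forall x, f x = g x) -> f = g.
Proof. by move=> fg; apply: val_inj; apply: funext. Qed.

Definition ball_values f : set R :=
  [set complex.Re `|f x| | x in [set x : X | `|x| <= 1]].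

(* The operator norm, the supremum of |f x| over the closed unit ball. *)
Definition dual_norm f : R[i] := (sup (ball_values f))%:C.

Lemma ReC_norm (z : R[i]) : (complex.Re `|z|)%:C = `|z|.
Proof. by apply: RRe_real; exact: normr_real. Qed.

Lemma ball_values_nonempty f : ball_values f !=set0.
Proof. by exists (complex.Re `|f 0|); exists 0 => //=; rewrite normr0. Qed.

Lemma ball_values_has_sup f : has_sup (ball_values f).
Proof.
split; first exact: ball_values_nonempty.
have /linear_boundedP : bounded_near f (nbhs 0).
  by apply/linear_bounded_continuous; exact: dual_continuous.
move=> [M [Mreal]] /(_ (M + 1)).
rewrite ltrDl ltr01 => /(_ isT) fM.
exists (complex.Re (`|M| + 1)) => _ [x x1 <-].
rewrite -lecR ReC_norm RRe_real ?realD ?normr_real ?num_real//.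
rewrite (le_trans (fM x))//.
rewrite (le_trans (y := (`|M| + 1) * `|x|))//; last first.
  by rewrite ler_piMr// addr_ge0.
by rewrite ler_wpM2r// lerD2r real_ler_norm.
Qed.

Lemma dual_norm_ge f x : `|x| <= 1 -> `|f x| <= dual_norm f.
Proof.
move=> x1; rewrite -ReC_norm lecR; apply: ub_le_sup; last by exists x.
by have [] := ball_values_has_sup f.
Qed.

Lemma dual_norm_le f (M : R) :
  (forall x, `|x| <= 1 -> `|f x| <= M%:C) -> dual_norm f <= M%:C.
Proof.
move=> fM; rewrite lecR; apply: ge_sup; first exact: ball_values_nonempty.
by move=> _ [x x1 <-]; rewrite -lecR ReC_norm; exact: fM.
Qed.

Lemma dual_norm_ge0 f : 0 <= dual_norm f.
Proof. by apply: le_trans (dual_norm_ge f (x := 0) _); rewrite ?normr0. Qed.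

Lemma le_dual_norm f x : `|f x| <= dual_norm f * `|x|.
Proof.
have [->|x0] := eqVneq x 0; first by rewrite linear0 !normr0 mulr0.
have nx0 : 0 < `|x| by rewrite normr_gt0.
rewrite -ler_pdivrMr//.
have := @dual_norm_ge f (`|x|^-1 *: x); rewrite normfZV// => /(_ (lexx _)).
by rewrite linearZ normrZ normfV normr_id mulrC.
Qed.

Lemma dual_norm_le_bound f (M : R) :
  (forall x, `|f x| <= M%:C * `|x|) -> 0 <= M -> dual_norm f <= M%:C.
Proof.
move=> fM M0; apply: dual_norm_le => x x1; apply: le_trans (fM x) _.
by rewrite ler_piMr// lecR.
Qed.

Lemma dual_normD f g : dual_norm (f + g) <= dual_norm f + dual_norm g.
Proof.
rewrite /dual_norm -rmorphD; apply: dual_norm_le => x x1.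
rewrite dualDE rmorphD (le_trans (ler_normD _ _))//.
by rewrite lerD// dual_norm_ge.
Qed.

Lemma dual_normZ_le (k : R[i]) f : dual_norm (k *: f) <= `|k| * dual_norm f.
Proof.
rewrite -(ReC_norm k) /dual_norm -rmorphM; apply: dual_norm_le => x x1.
rewrite dualZE normrM (rmorphM (real_complex R)) /=.
by rewrite (ReC_norm k) ler_wpM2l// dual_norm_ge.
Qed.

Lemma dual_normZ (k : R[i]) f : dual_norm (k *: f) = `|k| * dual_norm f.
Proof.
apply/eqP; rewrite eq_le dual_normZ_le/=.
have [->|k0] := eqVneq k 0; first by rewrite normr0 mul0r dual_norm_ge0.
rewrite -ler_pdivlMl ?normr_gt0// -normfV.
by rewrite -{1}[f](scalerK k0) dual_normZ_le.
Qed.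

Lemma dual_norm_eq0 f : dual_norm f = 0 -> f = 0.
Proof.
move=> f0; apply: dual_eqP => x; apply/eqP; rewrite -normr_le0.
by rewrite (le_trans (le_dual_norm f x))// f0 mul0r.
Qed.

HB.instance Definition _ := Lmodule_isNormed.Build R[i] dual_space
  dual_normD dual_normZ dual_norm_eq0.

Lemma dual_normE f : `|f| = dual_norm f. Proof. by []. Qed.

End Dual.

Section Bimodule.
Variables (R : realType) (A : comBanachAlgType R).

(* A Banach A-bimodule is a bimodule whose carrier is a
   completeNormedModType. *)
Record bimodule (X : normedModType R[i]) := Bimodule {
  lact : A -> X -> X;
  ract : X -> A -> X;
  lact_linearl : forall x, linear (lact^~ x);
  lact_linearr : forall a, linear (lact a);
  ract_linearl : forall a, linear (ract^~ a);
  ract_linearr : forall x, linear (ract x);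
  lactM : forall a b x, lact (a ** b) x = lact a (lact b x);
  ractM : forall a b x, ract x (a ** b) = ract (ract x a) b;
  lractA : forall a b x, ract (lact a x) b = lact a (ract x b);
  act_bounded : exists k : R, forall a x,
    `|lact a x| <= k%:C * `|a| * `|x| /\ `|ract x a| <= k%:C * `|a| * `|x|
}.

Definition phi_bimodule (phi : character_space A) (X : normedModType R[i])
    (M : bimodule X) : Prop :=
  forall a x, lact M a x = char_eval phi a *: x /\
              ract M x a = char_eval phi a *: x.

Definition derivation (X : normedModType R[i]) (M : bimodule X)
    (D : A -> X) : Prop :=
  [/\ linear D, continuous D
    & forall a b, D (a ** b) = ract M (D a) b + lact M a (D b)].

Section DualBimodule.
Variables (X : normedModType R[i]) (M : bimodule X).

Lemma act_bound : exists2 k : R, 0 <= k & forall a x,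
  `|lact M a x| <= k%:C * `|a| * `|x| /\ `|ract M x a| <= k%:C * `|a| * `|x|.
Proof.
have [k kP] := act_bounded M; exists `|k| => // a x.
have kk : k%:C * `|a| * `|x| <= `|k|%:C * `|a| * `|x|.
  by rewrite !ler_wpM2r// lecR ler_norm.
by have [la ra] := kP a x; split; exact: le_trans kk.
Qed.

Lemma bounded_functional (f : X -> R[i]^o) (k : R) : 0 <= k -> linear f ->
  (forall x, `|f x| <= k%:C * `|x|) -> f \in @is_functional R X.
Proof.
move=> k0 lf fk; apply/asboolP; split => //.
pose g : {linear X -> R[i]^o} :=
  HB.pack f (GRing.isLinear.Build R[i] X R[i]^o *:%R f lf).
apply: (@bounded_linear_continuous _ _ _ g).
apply/ex_bound; exists k%:C; apply/nbhs_norm0P; exists 1 => //= x /= x1.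
by rewrite (le_trans (fk x))// ler_piMr ?lecR// ltW.
Qed.

Lemma act_functional (T : X -> X) (k : R) (f : dual_space X) :
  0 <= k -> linear T -> (forall x, `|T x| <= k%:C * `|x|) ->
  (fun x => f (T x)) \in @is_functional R X.
Proof.
move=> k0 lT Tk; set g := fun x => f (T x).
have lg : linear g by move=> c x y; rewrite /g lT linearP.
have d0 := dual_norm_ge0 f.
have dE : (complex.Re (dual_norm f))%:C = dual_norm f by [].
have Re0 : 0 <= complex.Re (dual_norm f) by rewrite -lecR dE.
apply: (bounded_functional (k := complex.Re (dual_norm f) * k)) => //.
  exact: mulr_ge0.
move=> x; rewrite (rmorphM (real_complex R)) -mulrA.
exact: le_trans (le_dual_norm f (T x)) (ler_wpM2l d0 (Tk x)).
Qed.

Lemma norm_real (Y : normedModType R[i]) (y : Y) :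
  exists2 r : R, 0 <= r & `|y| = r%:C.
Proof.
have yE : (complex.Re `|y|)%:C = `|y|.
  by apply: RRe_real; exact: normr_real.
by exists (complex.Re `|y|); rewrite -?lecR yE ?normr_ge0.
Qed.

Lemma lact_functional a (f : dual_space X) :
  (fun x => f (ract M x a)) \in @is_functional R X.
Proof.
have [k k0 kP] := act_bound; have [r r0 rE] := norm_real a.
apply: (act_functional (k := k * r) f (mulr_ge0 k0 r0) (ract_linearl M a)).
by move=> x; rewrite (rmorphM (real_complex R)) /= -rE; have [] := kP a x.
Qed.

Lemma ract_functional a (f : dual_space X) :
  (fun x => f (lact M a x)) \in @is_functional R X.
Proof.
have [k k0 kP] := act_bound; have [r r0 rE] := norm_real a.
apply: (act_functional (k := k * r) f (mulr_ge0 k0 r0) (lact_linearr M a)).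
by move=> x; rewrite (rmorphM (real_complex R)) /= -rE; have [] := kP a x.
Qed.

Definition dual_lact a (f : dual_space X) : dual_space X :=
  DualSpace (lact_functional a f).

Definition dual_ract (f : dual_space X) a : dual_space X :=
  DualSpace (ract_functional a f).

Lemma dual_lact_linearl f : linear (dual_lact^~ f).
Proof.
move=> c a b; apply: dual_eqP => x.
change (f (ract M x (c *: a + b)) = c * f (ract M x a) + f (ract M x b)).
by rewrite ract_linearr linearP.
Qed.

Lemma dual_lact_linearr a : linear (dual_lact a).
Proof. by move=> c f g; apply: dual_eqP. Qed.

Lemma dual_ract_linearl a : linear (dual_ract^~ a).
Proof. by move=> c f g; apply: dual_eqP. Qed.

Lemma dual_ract_linearr f : linear (dual_ract f).
Proof.
move=> c a b; apply: dual_eqP => x.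
change (f (lact M (c *: a + b) x) = c * f (lact M a x) + f (lact M b x)).
by rewrite lact_linearl linearP.
Qed.

Lemma dual_lactM a b f : dual_lact (a ** b) f = dual_lact a (dual_lact b f).
Proof. by apply: dual_eqP => x /=; rewrite ractM. Qed.

Lemma dual_ractM a b f : dual_ract f (a ** b) = dual_ract (dual_ract f a) b.
Proof. by apply: dual_eqP => x /=; rewrite lactM. Qed.

Lemma dual_lractA a b f :
  dual_ract (dual_lact a f) b = dual_lact a (dual_ract f b).
Proof. by apply: dual_eqP => x /=; rewrite lractA. Qed.

Lemma dual_act_bounded : exists k : R, forall a (f : dual_space X),
  `|dual_lact a f| <= k%:C * `|a| * `|f| /\
  `|dual_ract f a| <= k%:C * `|a| * `|f|.
Proof.
have [k k0 kP] := act_bound; exists k => a f.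
have [r r0 rE] := norm_real a; have [s s0 sE] := norm_real f.
have kE : (k * r * s)%:C = k%:C * r%:C * s%:C.
  by rewrite !(rmorphM (real_complex R)).
have krs0 : 0 <= k * r * s by rewrite !mulr_ge0.
have krsE (x : X) : (k * r * s)%:C * `|x| = `|f| * (k%:C * `|a| * `|x|).
  by rewrite kE -rE -sE [in RHS]mulrA [in RHS](mulrC `|f|).
rewrite rE sE -kE; split; rewrite dual_normE; apply: dual_norm_le_bound => // x;
  rewrite krsE; apply: le_trans (le_dual_norm f _) _;
  by apply: (ler_wpM2l (dual_norm_ge0 f)); have [] := kP a x.
Qed.

(* (a . f) x = f (x . a) and (f . a) x = f (a . x) *)
Definition dual_bimodule : bimodule (dual_space X) :=
  Bimodule dual_lact_linearl dual_lact_linearr dual_ract_linearl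
    dual_ract_linearr dual_lactM dual_ractM dual_lractA dual_act_bounded.

End DualBimodule.
End Bimodule.

(* Main.v *)
(* Put J = ker phi `&` ker D.  By the derivation identity J is a closed ideal
   containing the square of every element of ker phi, so a character vanishing
   on J vanishes on ker phi and hence equals phi.  Spectral synthesis gives
   J = ker phi, i.e. D vanishes on ker phi.  Finally, if phi e = 1 then
   e ** e - e lies in ker phi, so D e = D (e ** e) = 2 D e and D e = 0. *)

Require Import Defs.
From HB Require Import structures.
From mathcomp Require Import all_boot all_order all_algebra.
From mathcomp Require Import complex.
From mathcomp Require Import all_classical all_reals.
From mathcomp Require Import topology normedtype.

Set Implicit Arguments.
Unset Strict Implicit.
Unset Printing Implicit Defensive.

Import Order.TTheory GRing.Theory Num.Theory.
Import numFieldNormedType.Exports.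

Local Open Scope classical_set_scope.
Local Open Scope ring_scope.
Local Open Scope complex_scope.

Section Characters.
Variables (R : realType) (A : comBanachAlgType R).
Implicit Types (phi psi : character_space A) (a b : A).

Lemma char_eval_linear phi : linear (char_eval phi : A -> R[i]^o).
Proof. by have /set_mem[] := valP phi. Qed.

HB.instance Definition _ phi :=
  GRing.isLinear.Build R[i] A R[i]^o *:%R (char_eval phi)
    (char_eval_linear phi).

Lemma char_evalM phi a b :
  char_eval phi (a ** b) = char_eval phi a * char_eval phi b.
Proof. by have /set_mem[_ + _] := valP phi; apply. Qed.

Lemma char_evalB phi a b :
  char_eval phi (a - b) = char_eval phi a - char_eval phi b.
Proof. exact: linearB. Qed.

Lemma char_evalZ phi (k : R[i]) a :
  char_eval phi (k *: a) = k * char_eval phi a.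
Proof. exact: linearZ. Qed.

Lemma char_eval_eq1 phi : exists e, char_eval phi e = 1.
Proof.
have /set_mem[_ _ [a a0]] := valP phi.
by exists ((char_eval phi a)^-1 *: a); rewrite char_evalZ mulVf.
Qed.

(** This splits [A] as [char_ker phi] plus the line through [e], so that a linear map is determined
    by its values on the kernel and at [e]. *)
Lemma char_ker_sub_unit phi e a : char_eval phi e = 1 ->
  char_ker phi (a - char_eval phi a *: e).
Proof.
by move=> e1; rewrite /char_ker /= char_evalB char_evalZ e1 mulr1 subrr.
Qed.

(** The kernel of [phi] has codimension one, so [psi] is the multiple [psi e] of [phi]. Since [psi]
    is nonzero and multiplicative, this scalar is a nonzero idempotent, hence 1. *)
Lemma char_ker_inj phi psi : char_ker phi `<=` char_ker psi -> psi = phi.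
Proof.
move=> phipsi; have [e phie] := char_eval_eq1 phi.
have psiE a : char_eval psi a = char_eval phi a * char_eval psi e.
  have := phipsi _ (char_ker_sub_unit a phie).
  by rewrite /char_ker /= char_evalB char_evalZ; exact: subr0_eq.
have psie_neq0 : char_eval psi e != 0.
  have [u psiu] := char_eval_eq1 psi.
  apply/eqP => psie0; move: (psiE u); rewrite psiu psie0 mulr0.
  by move/eqP; rewrite oner_eq0.
(* Evaluating [psiE] at [e ** e] gives [psi e * psi e = psi e], and the nonzero factor cancels. *)
have psie : char_eval psi e = 1.
  have := psiE (e ** e); rewrite !char_evalM phie !mul1r -[RHS]mulr1.
  exact: mulfI.
by apply: val_inj; apply: funext => a; have := psiE a; rewrite psie mulr1.
Qed.

End Characters.

Theorem proposition3p6 (R : realType) (A : comBanachAlgType R)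
    (phi : character_space A) :
  semisimple A -> regular A -> spectral_singleton phi ->
  forall (X : completeNormedModType R[i]) (M : bimodule A X),
    phi_bimodule phi M ->
    forall D : A -> dual_space X,
      derivation (dual_bimodule M) D -> forall a, D a = 0.
Proof.
move=> _ _ spec_phi X M phiM D [linD contD derD] a.
pose Dl : {linear A -> dual_space X} :=
  HB.pack D (GRing.isLinear.Build R[i] A (dual_space X) *:%R D linD).
have D0 : D 0 = 0 := linear0 Dl.
have DD : {morph D : x y / x + y} := linearD Dl.
have DZ k : {morph D : x / k *: x} := linearZ_LR Dl k.
(* Both dual actions are scalar multiplication through [phi], since functionals on [X] are linear;
   so [D] is a point derivation at [phi]. *)
have DM b c : D (b ** c) = char_eval phi c *: D b + char_eval phi b *: D c.
  rewrite derD; congr (_ + _); apply: dual_eqP => x.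
    change (D b (lact M c x) = char_eval phi c * D b x).
    by have [-> _] := phiM c x; rewrite linearZ.
  change (D c (ract M x b) = char_eval phi b * D c x).
  by have [_ ->] := phiM b x; rewrite linearZ.
(* Characters are not assumed continuous: synthesis supplies the closedness of
   the kernel. *)
have [[closed_ker [ker0 kerD kerZ kerM]] _] :
    closed_ideal (char_ker phi) /\ Co (char_ker phi) = [set phi].
  by move/seteqP: spec_phi => [_]; apply.
pose J := char_ker phi `&` D @^-1` [set 0].
have J_ker : J = char_ker phi.
  suff : [set J | closed_ideal J /\ Co J = [set phi]] J by rewrite spec_phi.
  split; first split.
  (* [{0}] is closed in the normed, hence Hausdorff, dual, so its preimage under the continuous [D]
     is closed. *)
  - apply: closedI => //; apply: preimage_closed => [x _|]; first exact: contD.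
    exact/accessible_closed_set1/hausdorff_accessible/norm_hausdorff.
  - split.
    + by split.
    + move=> b c [b0 Db] [c0 Dc]; split; first exact: kerD.
      by rewrite /= DD Db Dc addr0.
    + move=> k b [b0 Db]; split; first exact: kerZ.
      by rewrite /= DZ Db scaler0.
    (* The intersection with [char_ker phi] matters here: [phi c = 0] kills the term in [D b], about
       which nothing is known. *)
    + move=> b c [c0 Dc]; split; first exact: kerM.
      by rewrite /= DM c0 Dc scale0r scaler0 addr0.
  - apply/seteqP; split=> [psi psiJ|_ ->]; last by move=> b [].
    apply: char_ker_inj => b b0.
    have /psiJ/eqP : J (b ** b).
      by split; [exact: kerM|rewrite /= DM b0 !scale0r addr0].
    by rewrite char_evalM mulf_eq0 orbb => /eqP.
have D_ker b : char_ker phi b -> D b = 0 by rewrite -J_ker => -[].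
have [e phie] := char_eval_eq1 phi.
have DB b : D (b - e) = D b - D e := linearB Dl b e.
have De0 : D e = 0.
  have : D (e ** e - e) = 0.
    apply: D_ker; rewrite /char_ker /=.
    by rewrite char_evalB char_evalM phie mulr1 subrr.
  by rewrite DB DM phie !scale1r addrK.
(* [D] vanishes on the kernel component of [a] and on its component along [e]. *)
have := D_ker _ (char_ker_sub_unit a phie).
by rewrite -scaleNr DD DZ De0 scaler0 addr0.
Qed.
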